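(* Let $d\ge 1$ be an integer and let $H$ be a real inner product space with $\dim(H)=d+1$. Let $\{v_1,\dots,v_{d+1}\}$ be a basis of $H$, and let $u\in H$ be of the form $u=\sum_{i=1}^{d+1}t_iv_i$ with all $t_i\ge 0$, such that $u$ is not a scalar multiple of any single $v_i$ (in particular $u\ne 0$). Let $\beta_1,\dots,\beta_{d+1}>0$ be arbitrary, write $u=\sum_{i=1}^{d+1}\lambda_i\beta_iv_i$, and set $\tilde u=\left(\sum_{i=1}^{d+1}\lambda_i\right)^{-1}u$. Then $$\mathrm{g}_d\mathrm{sin}_0(v_1,\dots,v_{d+1})=\sum_{i=1}^{d+1}Q_i\cdot\mathrm{g}_d\mathrm{sin}_0(v_1,\dots,v_{i-1},u,v_{i+1},\dots,v_{d+1}),$$ where, for $1\le i\le d+1$, $$Q_i=\prod_{\substack{j=1\\ j\ne i}}^{d+1}\left(\frac{M_d\big(\text{the list }\beta_1v_1,\dots,\beta_{d+1}v_{d+1}\text{ with }\beta_iv_i\text{ replaced by }\tilde u\text{ and }\beta_jv_j\text{ removed}\big)}{M_d\big(\text{the list }\beta_1v_1,\dots,\beta_{d+1}v_{d+1}\text{ with }\beta_jv_j\text{ removed}\big)}\right)^{1/d},$$ and moreover $$Q_i=\prod_{\substack{j=1\\ j\ne i}}^{d+1}\left(\frac{\mathrm{dist}(\tilde u,L_{i,j})}{\mathrm{dist}(\beta_iv_i,L_{i,j})}\right)^{1/d},\qquad L_{i,j}=\mathrm{span}\{v_k:\ k\ne i,j\}.$$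
   Context: For vectors $w_1,\dots,w_d\in H$ (with $d<\dim(H)=d+1$), $M_d(w_1,\dots,w_d)=\left[\det\left(\{\langle w_i,w_j\rangle\}_{i,j=1}^d\right)\right]^{1/2}\ge 0$. Fix an orthonormal basis $\Phi$ of $H$ and let $\det$ be the determinant function with respect to $\Phi$ (the alternating multilinear function with value $1$ on $\Phi$). For $\dim(H)=d+1$ the signed function $\mathrm{g}_d\mathrm{sin}_0$ is $$\mathrm{g}_d\mathrm{sin}_0(w_1,\dots,w_{d+1})=\frac{\det(w_1,\dots,w_{d+1})}{\left(\prod_{j=1}^{d+1}M_d(w_1,\dots,w_{j-1},w_{j+1},\dots,w_{d+1})\right)^{1/d}},$$ with value $0$ if the denominator is $0$. The span of the empty set is $\{0\}$, and $\mathrm{dist}(x,L)$ is the distance from $x$ to the subspace $L$. *)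

(* Defs.v *)
From HB Require Import structures.
From mathcomp Require Import all_boot all_order all_algebra.
From mathcomp Require Import all_classical all_reals all_analysis.

Set Implicit Arguments.
Unset Strict Implicit.
Unset Printing Implicit Defensive.

Import Order.TTheory GRing.Theory Num.Theory.

Local Open Scope classical_set_scope.
Local Open Scope ring_scope.

Definition omit (T : Type) (d : nat) (w : 'I_d.+1 -> T) (j : 'I_d.+1) :
    'I_d -> T :=
  fun k => w (lift j k).

(* The content of a list of n vectors: the square root of its Gram
   determinant. A term of type {dot H for idfun} is a symmetric positive
   definite bilinear form, i.e., a real inner product. *)
Definition content (R : realType) (H : vectType R) (ip : {dot H for idfun})
    (n : nat) (w : 'I_n -> H) : R :=
  Num.sqrt (\det (\matrix_(i < n, j < n) ip (w i) (w j))).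

Definition det_wrt (R : realType) (H : vectType R) (n : nat)
    (Phi : n.-tuple H) (w : 'I_n -> H) : R :=
  \det (\matrix_(i < n, j < n) coord Phi j (w i)).

(* Division by 0 is 0, so this is 0 when the denominator is 0. *)
Definition gsin0 (R : realType) (H : vectType R) (ip : {dot H for idfun})
    (d : nat) (Phi : d.+1.-tuple H) (w : 'I_d.+1 -> H) : R :=
  det_wrt Phi w / (\prod_(j < d.+1) content ip (omit w j)) `^ d%:R^-1.

Definition dist_to (R : realType) (H : vectType R) (ip : {dot H for idfun})
    (x : H) (L : {vspace H}) : R :=
  inf [set Num.sqrt (ip (x - y) (x - y)) | y in [set` L]].

Definition span_omit2 (R : realType) (H : vectType R) (n : nat)
    (v : 'I_n -> H) (i j : 'I_n) : {vspace H} :=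
  <<[seq v k | k <- enum 'I_n & (k != i) && (k != j)]>>%VS.

Definition content_ratio (R : realType) (H : vectType R)
    (ip : {dot H for idfun}) (d : nat) (w : 'I_d.+1 -> H) (x : H)
    (i : 'I_d.+1) : R :=
  \prod_(j < d.+1 | j != i)
     (content ip (omit [eta w with i |-> x] j) / content ip (omit w j))
       `^ d%:R^-1.

(* Main.v *)
(** Replacing [v i] by [u = \sum_l a l *: v l] multiplies the determinant by
    [a i], so the content ratios in [Q i] turn [gsin0] of the modified list
    into [a i] times [gsin0] of [v], up to rescaling: scaling the vectors by
    [beta] and [u] by [c] multiplies each of the [d] factors of [Q i] by
    [(c / beta i) `^ (1/d)]. With [a i = lambda i * beta i] and
    [c = (\sum_l lambda l)^-1], the i-th summand becomes
    [lambda i / \sum_l lambda l] times [gsin0] of [v], and these weights sum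
    to 1. The formula with distances is base times height: subtracting from a
    vector its orthogonal projection onto the span of the others leaves the
    Gram determinant unchanged and makes it block diagonal. *)

Require Import Defs.
From mathcomp Require Import all_boot all_order all_algebra.
From mathcomp Require Import all_classical all_reals all_analysis.
From mathcomp Require Import ring.

(* [all_analysis] has its own [content]; this makes the one of [Defs] prevail. *)
Import Defs.

Set Implicit Arguments.
Unset Strict Implicit.
Unset Printing Implicit Defensive.

Import Order.TTheory GRing.Theory Num.Theory.

Local Open Scope ring_scope.

(** * Determinants and real powers *)

Lemma det_row_replace (R : comNzRingType) (n : nat) (i : 'I_n) (a : 'I_n -> R) :
  \det (\matrix_(k, l) (if k == i then a l else (k == l)%:R)) = a i.
Proof.
(* Column [i] is zero off the diagonal, and the minor at [(i, i)] is an identity matrix. *)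
rewrite (expand_det_col _ i) (bigD1 i) //= big1 => [|k ki]; last first.
  by rewrite mxE (negPf ki) mul0r.
rewrite mxE eqxx addr0 /cofactor -signr_odd addnn odd_double mul1r.
rewrite [X in \det X](_ : _ = 1%:M) ?det1 ?mulr1 //.
apply/matrixP => k l; rewrite !mxE eq_sym (negPf (neq_lift i k)).
by rewrite (inj_eq lift_inj).
Qed.

Lemma prod_powR (R : realType) (I : finType) (P : pred I) (F : I -> R) (r : R) :
  (forall i, 0 <= F i) ->
  \prod_(i | P i) F i `^ r = (\prod_(i | P i) F i) `^ r.
Proof.
move=> F0.
(* Nonnegativity of the partial product is carried through the induction, as [powRM] asks for it. *)
suff [] : \prod_(i | P i) F i `^ r = (\prod_(i | P i) F i) `^ r /\
          0 <= \prod_(i | P i) F i by [].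
elim/big_rec2 : _ => [|i x y _ [-> x0]]; first by rewrite powR1 ler01.
by rewrite powRM // mulr_ge0.
Qed.

(** * Free families and replacement of one vector *)

Section VectType.
Variables (R : realType) (H : vectType R).

Lemma free_mktupleP (n : nat) (w : 'I_n -> H) :
  reflect (forall c : 'I_n -> R, \sum_i c i *: w i = 0 -> forall i, c i = 0)
          (free (mktuple w)).
Proof.
have E (c : 'I_n -> R) : \sum_i c i *: (mktuple w)`_i = \sum_i c i *: w i.
  by apply: eq_bigr => i _; rewrite -tnth_nth tnth_mktuple.
by apply: (iffP freeP) => h c e; apply: h; rewrite -[RHS]e E.
Qed.

Lemma free_omit (n : nat) (w : 'I_n.+1 -> H) (j : 'I_n.+1) :
  free (mktuple w) -> free (mktuple (omit w j)).
Proof.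
move=> /free_mktupleP fw; apply/free_mktupleP => c e k.
pose c' l := if unlift j l is Some k then c k else 0.
have := fw c' _ (lift j k); rewrite /c' liftK; apply.
rewrite (bigD1_ord j) //= unlift_none scale0r add0r -[RHS]e.
by apply: eq_bigr => l _; rewrite liftK.
Qed.

Lemma free_scale (n : nat) (w : 'I_n -> H) (b : 'I_n -> R) :
  (forall k, b k != 0) -> free (mktuple w) ->
  free (mktuple (fun k => b k *: w k)).
Proof.
move=> b0 /free_mktupleP fw; apply/free_mktupleP => c e k.
have /eqP : c k * b k = 0.
  apply: (fw (fun k => c k * b k)); rewrite -[RHS]e.
  by apply: eq_bigr => l _; rewrite scalerA.
by rewrite mulf_eq0 (negPf (b0 k)) orbF => /eqP.
Qed.

Lemma replace_lincomb (n : nat) (w : 'I_n -> H) (a : 'I_n -> R) (i k : 'I_n) :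
  [eta w with i |-> \sum_l a l *: w l] k =
  \sum_l (if k == i then a l else (k == l)%:R) *: w l.
Proof.
rewrite /=; case: eqP => // _; rewrite (bigD1 k) //= eqxx scale1r big1 ?addr0//.
by move=> l lk; rewrite eq_sym (negPf lk) scale0r.
Qed.

Lemma free_replace (n : nat) (w : 'I_n -> H) (a : 'I_n -> R) (i : 'I_n) :
  free (mktuple w) -> a i != 0 ->
  free (mktuple [eta w with i |-> \sum_l a l *: w l]).
Proof.
move=> /free_mktupleP fw ai; apply/free_mktupleP => c e.
(* These are the coefficients on the [w l] once the replaced vector is expanded; at [l = i] only
   [c i * a i] remains. *)
have e2 l : (if l == i then 0 else c l) + c i * a l = 0.
  apply: (fw (fun l => (if l == i then 0 else c l) + c i * a l)).
  rewrite -[RHS]e (bigD1 i) //= [in RHS](bigD1 i) //= eqxx add0r.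
  rewrite scaler_sumr [in RHS](bigD1 i) //= !scalerA -addrA; congr (_ + _).
  rewrite -big_split /=; apply: eq_bigr => k /negPf ->.
  by rewrite addrC scalerA scalerDl.
have ci : c i = 0.
  have /eqP := e2 i; rewrite eqxx add0r mulf_eq0 (negPf ai) orbF.
  by move/eqP.
by move=> k; have := e2 k; rewrite ci mul0r addr0; case: eqP => [->|].
Qed.

Lemma sub_lincomb_omit (n : nat) (w : 'I_n.+1 -> H) (i : 'I_n.+1)
    (c : 'I_n -> R) :
  w i - \sum_k c k *: omit w i k =
  \sum_l (if unlift i l is Some k then - c k else 1) *: w l.
Proof.
rewrite (bigD1_ord i) //= unlift_none scale1r -sumrN.
by congr (_ + _); apply: eq_bigr => k _; rewrite liftK scaleNr.
Qed.

(** The new coordinate matrix is the old one multiplied on the left by the identity matrix with row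
    [i] replaced by [a]. *)
Lemma det_wrt_replace (n : nat) (Phi : n.-tuple H) (w : 'I_n -> H)
    (a : 'I_n -> R) (i : 'I_n) :
  det_wrt Phi [eta w with i |-> \sum_l a l *: w l] = a i * det_wrt Phi w.
Proof.
rewrite /det_wrt -(det_row_replace i a) -det_mulmx; congr (\det _).
apply/matrixP => k j; rewrite !mxE replace_lincomb linear_sum.
by apply: eq_bigr => l _; rewrite linearZ !mxE.
Qed.

End VectType.

(** * Gram determinants and their positivity *)

Section InnerProduct.
Variables (R : realType) (H : vectType R) (ip : {dot H for idfun}).

Local Notation gram w := (\matrix_(i, j) ip (w i) (w j)).

Lemma ip_ge0 x : 0 <= ip x x.
Proof.
have [->|x0] := eqVneq x 0; first by rewrite linear0l.
exact/ltW/neq0_dnorm_gt0.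
Qed.

Lemma content_ge0 (n : nat) (w : 'I_n -> H) : 0 <= content ip w.
Proof. exact: sqrtr_ge0. Qed.

Lemma gram_lincomb (n : nat) (w : 'I_n -> H) (A : 'M[R]_n) :
  gram (fun k => \sum_l A k l *: w l) = A *m gram w *m A^T.
Proof.
apply/matrixP => i j; rewrite !mxE linear_sumr.
apply: eq_bigr => l _; rewrite linearZr_LR /= linear_sumlz !mxE mulrC.
by congr (_ * _); apply: eq_bigr => k _; rewrite linearZl_LR /= mxE.
Qed.

Lemma det_gram_replace (n : nat) (w : 'I_n -> H) (a : 'I_n -> R) (i : 'I_n) :
  \det (gram [eta w with i |-> \sum_l a l *: w l]) = a i ^+ 2 * \det (gram w).
Proof.
pose A : 'M[R]_n := \matrix_(k, l) (if k == i then a l else (k == l)%:R).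
have -> : gram [eta w with i |-> \sum_l a l *: w l] = A *m gram w *m A^T.
  rewrite -gram_lincomb; apply/matrixP => k l; rewrite !mxE.
  rewrite !replace_lincomb.
  by congr (ip _ _); apply: eq_bigr => m _; rewrite mxE.
by rewrite !det_mulmx det_tr det_row_replace mulrAC.
Qed.

(** Orthogonality kills row [i] of the Gram matrix off the diagonal, so the expansion along that row
    has one term. *)
Lemma det_gram_orth (n : nat) (w : 'I_n.+1 -> H) (i : 'I_n.+1) :
  (forall j, ip (w i) (omit w i j) = 0) ->
  \det (gram w) = ip (w i) (w i) * \det (gram (omit w i)).
Proof.
move=> wi; rewrite (expand_det_row _ i) (bigD1_ord i) //= big1 => [|k _].
  rewrite mxE addr0 /cofactor -signr_odd addnn odd_double mul1r.
  by congr (_ * \det _); apply/matrixP => k l; rewrite !mxE.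
by rewrite mxE [ip _ _]wi mul0r.
Qed.

(** The vector [y] is a combination of the [w l] with coefficient 1 at [i], so putting it in place
    of [w i] multiplies the Gram determinant by 1. *)
Lemma det_gram_sub_orth (n : nat) (w : 'I_n.+1 -> H) (i : 'I_n.+1)
    (c : 'I_n -> R) :
  let y := w i - \sum_k c k *: omit w i k in
  (forall j, ip y (omit w i j) = 0) ->
  \det (gram w) = ip y y * \det (gram (omit w i)).
Proof.
move=> y yw.
pose a l := if unlift i l is Some k then - c k else 1.
have := det_gram_replace w a i; rewrite [a i]/a unlift_none expr1n mul1r => <-.
rewrite -sub_lincomb_omit -/y (@det_gram_orth _ _ i) /= ?eqxx.
  congr (_ * \det _); apply/matrixP => k l; rewrite !mxE /omit /=.
  by rewrite ![lift i _ == i]eq_sym !(negPf (neq_lift _ _)).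
by move=> j; rewrite /omit /= eq_sym (negPf (neq_lift _ _)); exact: yw.
Qed.

(** The coefficients solve the normal equations, whose matrix is the invertible Gram matrix. *)
Lemma orth_projection (n : nat) (w : 'I_n -> H) (x : H) :
  \det (gram w) != 0 ->
  exists c : 'I_n -> R, forall j, ip (x - \sum_k c k *: w k) (w j) = 0.
Proof.
move=> dw; pose b : 'rV[R]_n := \row_j ip x (w j).
exists (fun k => (b *m invmx (gram w)) 0 k) => j.
have /matrixP /(_ 0 j) : b *m invmx (gram w) *m gram w = b.
  by rewrite mulmxKV // unitmxE unitfE.
rewrite !mxE linearBl linear_sumlz => e.
apply/eqP; rewrite subr_eq0 -[eqbLHS]e; apply/eqP/eq_bigr => k _.
by rewrite linearZl_LR [X in _ * X = _]mxE.
Qed.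

(** By induction, the remaining vectors have a positive Gram determinant, so the first one can be
    projected onto their span; freeness makes the residual nonzero. *)
Lemma det_gram_gt0 (n : nat) (w : 'I_n -> H) :
  free (mktuple w) -> 0 < \det (gram w).
Proof.
elim: n w => [|n IH] w fw; first by rewrite det_mx00.
have gt0 := IH _ (free_omit ord0 fw).
have [c yw] := orth_projection (w ord0) (lt0r_neq0 gt0).
rewrite (det_gram_sub_orth yw) mulr_gt0 // neq0_dnorm_gt0 //.
apply/eqP => y0.
rewrite sub_lincomb_omit in y0.
move/free_mktupleP : fw => /(_ _ y0 ord0); rewrite unlift_none.
by apply/eqP; exact: oner_neq0.
Qed.

Lemma content_gt0 (n : nat) (w : 'I_n -> H) :
  free (mktuple w) -> 0 < content ip w.
Proof. by move=> fw; rewrite sqrtr_gt0 det_gram_gt0. Qed.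

(** * Distances to subspaces and contents *)

Lemma dist_to_orth (x y : H) (L : {vspace H}) :
  y \in L -> (forall z, z \in L -> ip (x - y) z = 0) ->
  dist_to ip x L = Num.sqrt (ip (x - y) (x - y)).
Proof.
move=> yL xy; apply/eqP; rewrite eq_le; apply/andP; split.
  apply: ge_inf; last by exists y.
  by exists 0 => _ [z _ <-]; exact: sqrtr_ge0.
apply: lb_le_inf; first by exists (Num.sqrt (ip (x - y) (x - y))), y.
move=> _ [z zL <-]; rewrite ler_wsqrtr //.
have yzL : y - z \in L by rewrite memvB.
(* Pythagoras: the two summands are orthogonal, so no [z] in [L] is closer to [x] than [y]. *)
have -> : x - z = (x - y) + (y - z) by rewrite addrA subrK.
by have -> := hnormDd (xy _ yzL); rewrite lerDl ip_ge0.
Qed.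

Lemma content_dist (n : nat) (w : 'I_n.+1 -> H) (i : 'I_n.+1) :
  free (mktuple (omit w i)) ->
  content ip w =
  dist_to ip (w i) <<mktuple (omit w i)>>%VS * content ip (omit w i).
Proof.
move=> fw; have [c yw] := orth_projection (w i) (lt0r_neq0 (det_gram_gt0 fw)).
rewrite /content (det_gram_sub_orth yw) sqrtrM ?ip_ge0 //.
congr (_ * _); rewrite (@dist_to_orth _ (\sum_k c k *: omit w i k)) //.
  apply: memv_suml => k _; apply/memvZ/memv_span; apply/mapP.
  by exists k; rewrite ?mem_enum.
move=> z /coord_span ->; rewrite linear_sumr big1 // => k _.
by rewrite -tnth_nth tnth_mktuple linearZr_LR /= [X in _ * X]yw mulr0.
Qed.

Lemma content_scale (n : nat) (w : 'I_n -> H) (b : 'I_n -> R) :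
  (forall k, 0 <= b k) ->
  content ip (fun k => b k *: w k) = (\prod_k b k) * content ip w.
Proof.
move=> b0; rewrite /content.
have -> : gram (fun k => b k *: w k) =
    diag_mx (\row_k b k) *m gram w *m diag_mx (\row_k b k).
  apply/matrixP => i j; rewrite mul_mx_diag mul_diag_mx !mxE.
  by rewrite linearZl_LR linearZr_LR /= -mulrA [_ * b j]mulrC.
rewrite !det_mulmx det_diag mulrAC -expr2 sqrtrM ?sqr_ge0 // sqrtr_sqr.
under eq_bigr do rewrite mxE.
by rewrite ger0_norm // prodr_ge0.
Qed.


(** * Content ratios *)

Lemma content_ratio_scale (d : nat) (v : 'I_d.+1 -> H) (b : 'I_d.+1 -> R)
    (u : H) (c : R) (i : 'I_d.+1) :
  (0 < d)%N -> (forall k, 0 < b k) -> 0 <= c ->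
  content_ratio ip (fun k => b k *: v k) (c *: u) i =
  c / b i * content_ratio ip v u i.
Proof.
move=> d0 b0 c0; pose bv k := b k *: v k; pose r := c / b i.
have r0 : 0 <= r by rewrite divr_ge0 // ltW.
have E j : j != i ->
    content ip (omit [eta bv with i |-> c *: u] j) / content ip (omit bv j) =
    r * (content ip (omit [eta v with i |-> u] j) / content ip (omit v j)).
  move=> ji; pose b' := [eta b with i |-> c].
  have -> : omit [eta bv with i |-> c *: u] j =
      (fun k => b' (lift j k) *: omit [eta v with i |-> u] j k).
    by apply/funext => k; rewrite /omit /b' /=; case: eqP.
  rewrite content_scale; last first.
    by move=> k; rewrite /b' /=; case: ifP => // _; exact: ltW.
  rewrite (content_scale (omit v j) (b := fun k => b (lift j k))); last first.
    by move=> k; exact: ltW.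
  (* As [j != i], index [i] survives the omission of [j]; there alone the scale factors differ, [c]
     against [b i]. *)
  have -> : \prod_k b' (lift j k) = r * \prod_k b (lift j k).
    case: (unliftP j i) => [i' ei|ei]; last by rewrite ei eqxx in ji.
    rewrite (bigD1 i') //= [in RHS](bigD1 i') //= mulrA -ei eqxx.
    rewrite divfK ?lt0r_neq0 //; congr (_ * _); apply: eq_bigr => k ki.
    by rewrite ei (inj_eq lift_inj) (negPf ki).
  by rewrite invfM mulrACA mulfK //; apply/lt0r_neq0/prodr_gt0.
rewrite /content_ratio.
rewrite (eq_bigr _ (fun j ji => congr1 (@powR R ^~ _) (E j ji))).
under eq_bigr do rewrite (powRM _ r0 (divr_ge0 (content_ge0 _) (content_ge0 _))).
(* There are exactly [d] indices [j != i], so the [d] copies of [r] to the power [1/d] multiply to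
   [r]. *)
rewrite big_split /= prodr_const cardC1 card_ord; congr (_ * _).
by rewrite -powR_mulrn ?powR_ge0 // -powRrM mulVf ?powRr1 // pnatr_eq0 -lt0n.
Qed.

Lemma content_ratio_gsin0 (d : nat) (Phi : d.+1.-tuple H) (v : 'I_d.+1 -> H)
    (a : 'I_d.+1 -> R) (i : 'I_d.+1) :
  let u := \sum_l a l *: v l in
  free (mktuple v) ->
  content_ratio ip v u i * gsin0 ip Phi [eta v with i |-> u] =
  a i * gsin0 ip Phi v.
Proof.
move=> u fv; rewrite /gsin0 det_wrt_replace.
(* For [a i = 0] the replaced list may have vanishing contents, but its determinant is 0 and both
   sides vanish. *)
have [->|ai] := eqVneq (a i) 0; first by rewrite !mul0r mulr0.
pose A j := content ip (omit [eta v with i |-> u] j).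
pose B j := content ip (omit v j).
have A0 j : 0 < A j by apply/content_gt0/free_omit/free_replace.
have B0 j : 0 < B j by apply/content_gt0/free_omit.
(* Omitting index [i] removes the replaced vector; this supplies the factor [j = i] that the content
   ratio skips. *)
have AB : A i = B i.
  congr (content ip _); apply/funext => k; rewrite /omit /=.
  by rewrite eq_sym (negPf (neq_lift _ _)).
rewrite /content_ratio prod_powR; last first.
  by move=> j; rewrite divr_ge0 ?content_ge0.
have E : (\prod_(j | j != i) (A j / B j)) `^ d%:R^-1 *
    (\prod_j B j) `^ d%:R^-1 = (\prod_j A j) `^ d%:R^-1.
  rewrite -powRM; last 2 first.
  - by apply: prodr_ge0 => j _; rewrite divr_ge0 // ltW.
  - by apply: prodr_ge0 => j _; rewrite ltW.
  rewrite prodf_div [\prod_j A j](bigD1 i) // [\prod_j B j](bigD1 i) //= AB.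
  by rewrite mulrCA divfK // lt0r_neq0 // prodr_gt0.
rewrite -[(\prod_j content _ (omit (fun_of_simpl _) j)) `^ _]E.
have x0 : (\prod_(j | j != i) (A j / B j)) `^ d%:R^-1 != 0.
  by rewrite lt0r_neq0 // powR_gt0 // prodr_gt0 // => j _; rewrite divr_gt0.
have y0 : (\prod_j B j) `^ d%:R^-1 != 0.
  by rewrite lt0r_neq0 // powR_gt0 // prodr_gt0.
rewrite -/B; field.
by rewrite x0 y0.
Qed.

(** For each [j], both contents are base times height over the same base, the scaled vectors with
    [i] and [j] omitted; the common base cancels. *)
Lemma content_ratio_dist (d : nat) (v : 'I_d.+1 -> H) (b : 'I_d.+1 -> R)
    (x : H) (i : 'I_d.+1) :
  free (mktuple v) -> (forall k, b k != 0) ->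
  let bv k := b k *: v k in
  content_ratio ip bv x i =
  \prod_(j < d.+1 | j != i)
     (dist_to ip x (span_omit2 v i j) / dist_to ip (bv i) (span_omit2 v i j))
       `^ d%:R^-1.
Proof.
case: d v b i => [|d] v b i fv b0 bv.
  (* With a single index both products are empty; omitting two indices needs at least two. *)
  by rewrite /content_ratio !big1 // => j; rewrite (ord1 i) (ord1 j).
apply: eq_bigr => j ji; congr (_ `^ _).
case: (unliftP j i) => [i' ei|ei]; last by rewrite ei eqxx in ji.
set w := [eta bv with i |-> x].
have fo : free (mktuple (omit (omit bv j) i')).
  exact/free_omit/free_omit/free_scale.
have wo : omit (omit w j) i' = omit (omit bv j) i'.
  apply/funext => k; rewrite /omit /w /= ei (inj_eq lift_inj).
  by rewrite eq_sym (negPf (neq_lift _ _)).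
have so : <<mktuple (omit (omit bv j) i')>>%VS = span_omit2 v i j.
  apply/eqP; rewrite eqEsubv; apply/andP; split; apply/span_subvP => y.
    move=> /mapP[k _ ->]; apply/memvZ/memv_span/map_f.
    rewrite mem_filter mem_enum andbT ei (inj_eq lift_inj).
    by rewrite ![lift _ _ == _]eq_sym !neq_lift.
  move=> /mapP[k]; rewrite mem_filter mem_enum andbT => /andP[ki kj] ->.
  case: (unliftP j k) => [k' ek|ek]; last by rewrite ek eqxx in kj.
  case: (unliftP i' k') => [k'' ek'|ek']; last by rewrite ek ek' -ei eqxx in ki.
  (* Nonzero scale factors leave the span unchanged. *)
  rewrite -[v k](scalerK (b0 k)) memvZ // memv_span //; apply/mapP.
  by exists k''; rewrite ?mem_enum // /omit -ek' -ek.
rewrite (content_dist (w := omit w j) (i := i')) wo //.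
rewrite (content_dist (w := omit bv j) (i := i')) // so.
have -> : omit w j i' = x by rewrite /omit /w /= -ei eqxx.
have -> : omit bv j i' = bv i by rewrite /omit -ei.
rewrite invfM mulrACA divff ?mulr1 //.
exact/lt0r_neq0/content_gt0.
Qed.

End InnerProduct.

Theorem mainTheorem5 (R : realType) (d : nat) (hd : (0 < d)%N)
    (H : vectType R) (hdim : \dim {:H} = d.+1) (ip : {dot H for idfun})
    (Phi : d.+1.-tuple H) (hPhi : basis_of {:H} Phi)
    (hPhi1 : orthonormal ip Phi)
    (v : 'I_d.+1 -> H) (hv : basis_of {:H} [tuple v i | i < d.+1])
    (t : 'I_d.+1 -> R) (ht : forall i, 0 <= t i)
    (u : H) (hu : u = \sum_(i < d.+1) t i *: v i)
    (hu_nmul : forall (i : 'I_d.+1) (c : R), u <> c *: v i)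
    (beta : 'I_d.+1 -> R) (hbeta : forall i, 0 < beta i)
    (lambda : 'I_d.+1 -> R)
    (hlambda : u = \sum_(i < d.+1) (lambda i * beta i) *: v i) :
  let bv := fun i => beta i *: v i in
  let ut := (\sum_(i < d.+1) lambda i)^-1 *: u in
  let Q := content_ratio ip bv ut in
  gsin0 ip Phi v = \sum_(i < d.+1) Q i * gsin0 ip Phi [eta v with i |-> u]
  /\ forall i : 'I_d.+1,
       Q i = \prod_(j < d.+1 | j != i)
               (dist_to ip ut (span_omit2 v i j)
                / dist_to ip (bv i) (span_omit2 v i j)) `^ d%:R^-1.
Proof.
move=> bv ut Q.
have fv : free (mktuple v) := basis_free hv.
have lb0 i : 0 <= lambda i.
  suff <- : t i / beta i = lambda i by rewrite divr_ge0 // ltW.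
  (* Both sides are coordinates of [u] in the free family [v]. *)
  suff -> : t i = lambda i * beta i by rewrite mulfK // lt0r_neq0.
  apply/eqP; rewrite -subr_eq0; apply/eqP; move: i.
  apply: (free_mktupleP _ fv (fun i => t i - lambda i * beta i)).
  under eq_bigr do rewrite scalerBl.
  by rewrite sumrB -hu -hlambda subrr.
have s0 : \sum_i lambda i != 0.
  (* A zero sum of nonnegative terms would force every [lambda i] to vanish, making [u] the zero
     multiple of a basis vector. *)
  apply/eqP => /(psumr_eq0P (fun i _ => lb0 i)) l0.
  apply: (hu_nmul ord0 0); rewrite hlambda scale0r big1 // => i _.
  by rewrite l0 // mul0r scale0r.
split; last by move=> i; apply: content_ratio_dist => // k; exact: lt0r_neq0.
have E i : Q i * gsin0 ip Phi [eta v with i |-> u] =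
    lambda i * ((\sum_i lambda i)^-1 * gsin0 ip Phi v).
  rewrite /Q /bv /ut content_ratio_scale ?invr_ge0 ?sumr_ge0 //.
  rewrite -mulrA hlambda content_ratio_gsin0 //.
  have bi : beta i != 0 by rewrite lt0r_neq0.
  by field; rewrite s0 bi.
under eq_bigr do rewrite E.
by rewrite -mulr_suml mulrA divff // mul1r.
Qed.
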